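(* Let $X$ be a locally finite partially ordered set, $F$ a field, $A=I(X,F)$ the incidence algebra and $C=\mathrm{Co}(X,F)$ the incidence coalgebra. Then: 1. $$\mathrm{Aut}\,C=(\mathrm{In}(\mathrm{Aut}\,C)\cdot\mathrm{Mult}\,C)\rtimes \mathrm{Aut}_CX=\mathrm{In}_1(\mathrm{Aut}\,C)\rtimes\mathrm{Mult}\,C\rtimes\mathrm{Aut}_CX.$$ 2. The automorphism groups $\mathrm{Aut}\,C$ and $\mathrm{Aut}\,A$ are antiisomorphic; for example, an antiisomorphism $\mathrm{Aut}\,C\to\mathrm{Aut}\,A$ is given by the mapping $\Theta$.
   Context: Locally finite means that every interval $[x,y]=\{z\in X\mid x\le z\le y\}$ ($x\le y$) is finite. Incidence coalgebra $C=\mathrm{Co}(X,F)$: the $F$-space with basis all intervals $[x,y]$, $x\le y$ in $X$, with comultiplication $\Delta([x,y])=\sum_{x\le z\le y}[x,z]\otimes[z,y]$ and counit $\varepsilon([x,y])=1$ if $x=y$, $0$ otherwise. $\mathrm{Aut}\,C$ is the group (under composition) of bijective linear maps $\varphi:C\to C$ with $(\varphi\otimes\varphi)\Delta=\Delta\varphi$ and $\varepsilon\varphi=\varepsilon$. Incidence algebra $A=I(X,F)$: functions $f:X\times X\to F$ with $f(x,y)=0$ unless $x\le y$, with pointwise linear operations and product $(fg)(x,y)=\sum_{x\le z\le y}f(x,z)g(z,y)$. $\mathrm{Aut}\,A$ is its group of $F$-algebra automorphisms. Dual algebra: $C^*=\mathrm{Hom}_F(C,F)$ with product $(\chi\circ\xi)(c)=\sum_i\chi(a_i)\xi(b_i)$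 if $\Delta(c)=\sum_i a_i\otimes b_i$, and identity $\varepsilon$. There are mutually inverse algebra isomorphisms $\Phi:C^*\to A$, $\Phi(\chi)(x,y)=\chi([x,y])$ and $\Psi:A\to C^*$, $\Psi(f)([x,y])=f(x,y)$. For $\varphi\in\mathrm{End}_FC$ let $\varphi^*:C^*\to C^*$, $\varphi^*(\chi)=\chi\varphi$. Define $\Theta:\mathrm{End}_FC\to\mathrm{End}_FA$ by $\Theta(\varphi)=\Phi\varphi^*\Psi$; it restricts to an injective antihomomorphism $\mathrm{Aut}\,C\to\mathrm{Aut}\,A$. For an invertible $v\in A$ the inner automorphism determined by $v$ is $f\mapsto v^{-1}fv$. Let $M_1=\{f\in A\mid f(x,x)=0\text{ for all }x\}$. $\mathrm{In}_1(\mathrm{Aut}\,A)$ is the group of inner automorphisms determined by elements $1+g$, $g\in M_1$. $\mathrm{In}(\mathrm{Aut}\,C)$ is the group of those $\nu\in\mathrm{Aut}\,C$ for which $\nu^*$ is an inner automorphism of the algebra $C^*$; $\mathrm{In}_1(\mathrm{Aut}\,C)=\Theta^{-1}(\mathrm{In}_1(\mathrm{Aut}\,A))$ (preimage in $\mathrm{Aut}\,C$). A multiplicative system is a family of nonzero elements $\{d_{xy}\in F\mid x<y\}$ with $d_{xy}=d_{xz}d_{zy}$ whenever $x<z<y$. $\mathrm{Mult}\,C$ is the group of automorphisms $\lambda$ of $C$ of the form $\lambda([x,y])=d_{xy}[x,y]$ for $x<y$, $\lambda([x,x])=[x,x]$, for multiplicative systems $\{d_{xy}\}$. $\mathrm{Aut}\,X$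 is the group of order automorphisms of $X$; $\mathrm{Aut}_CX$ is the group of automorphisms of $C$ given by $[x,y]\mapsto[\tau(x),\tau(y)]$ for $\tau\in\mathrm{Aut}\,X$. $G\rtimes H$ denotes the (internal) semidirect product with $G$ normal; the iterated product is read from the left. *)

(* Defs.v *)
From HB Require Import structures.
From mathcomp Require Import all_boot all_order all_algebra finmap.
From mathcomp Require Import boolp classical_sets functions cardinality.
From mathcomp Require Import monalg.

Set Implicit Arguments.
Unset Strict Implicit.
Unset Printing Implicit Defensive.

Import Order.TTheory GRing.Theory.
Local Open Scope classical_set_scope.
Local Open Scope ring_scope.

Section Groups.
Variable G : groupType.
Implicit Types N H K : set G.

Definition is_subgroup N : Prop := group_closed [in N].

Lemma is_subgroupP N :
  is_subgroup N <-> N 1%g /\ forall x y, N x -> N y -> N (x * y^-1)%g.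
Proof.
split=> -[N1 ND].
  split=> [|x y Nx Ny]; first exact: (set_mem N1).
  by apply: set_mem; apply: (ND x y); exact: mem_set.
split; first exact: (mem_set N1).
by move=> x y Nx Ny; apply: (mem_set (ND x y _ _)); exact: set_mem.
Qed.

Definition setprod N H : set G := [set (n * h)%g | n in N & h in H].

(* K is the internal semidirect product of its normal subgroup N by H. *)
Definition internal_sdprod N H K : Prop :=
  [/\ is_subgroup N, is_subgroup H, K = setprod N H,
      N `&` H = [set 1%g] & forall n k, N n -> K k -> N (n ^ k)%g].

End Groups.

Definition antiisomorphism (G H : groupType) (f : G -> H) : Prop :=
  bijective f /\ forall x y, f (x * y)%g = (f y * f x)%g.

Definition antiisomorphic (G H : groupType) : Prop :=
  exists f : G -> H, antiisomorphism f.

(* theta is f |-> v^-1 f v (in particular v is invertible).  The inverse is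
   spelled out because I(X,F) is the zero ring when X is empty, while
   MathComp's unit rings are nonzero. *)
Definition inner_by (R : pzRingType) (v : R) (theta : R -> R) : Prop :=
  exists w : R, [/\ w * v = 1, v * w = 1 & forall f, theta f = w * f * v].

Lemma bijective_inverse (T : Type) (f : T -> T) :
  bijective f -> {g : T -> T | cancel f g /\ cancel g f}.
Proof. by move=> bf; apply: cid; case: bf => g fK gK; exists g. Qed.

Section Free.
Variables (F : fieldType).
Implicit Types K L : choiceType.

(* The linear extension to {malg F[K]} of a map defined on the basis K. *)
Definition linext K (V : lmodType F) (h : K -> V) (c : {malg F[K]}) : V :=
  \sum_(k <- msupp c) c@_k *: h k.

(* {malg F[K * L]} serves as the tensor product of {malg F[K]} and
   {malg F[L]}; the basis vector << (k, l) >> is << k >> (x) << l >>. *)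
Definition tensor K L (a : {malg F[K]}) (b : {malg F[L]}) :
    {malg F[(K * L)%type]} :=
  linext (fun k => linext (fun l => << (k, l) >> : {malg F[(K * L)%type]}) b) a.

Definition tensor_map K L K' L' (phi : {malg F[K]} -> {malg F[K']})
    (psi : {malg F[L]} -> {malg F[L']}) :
    {malg F[(K * L)%type]} -> {malg F[(K' * L')%type]} :=
  linext (fun p : K * L => tensor (phi << p.1 >>) (psi << p.2 >>)).

Definition tensor_form K L (chi : {malg F[K]} -> F^o)
    (xi : {malg F[L]} -> F^o) : {malg F[(K * L)%type]} -> F^o :=
  linext (fun p : K * L => chi << p.1 >> * xi << p.2 >> : F^o).

Section Theory.
Variables (K : choiceType) (V : lmodType F).
Implicit Types (h : K -> V) (c : {malg F[K]}).

Lemma linextEw h c (d : {fset K}) :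
  {subset msupp c <= d} -> linext h c = \sum_(k <- d) c@_k *: h k.
Proof.
move=> /fsubsetP le_cd; rewrite /linext (big_fset_incl _ le_cd)//.
by move=> k _ /mcoeff_outdom ->; rewrite scale0r.
Qed.

Lemma linext_is_linear h : linear (linext h).
Proof.
move=> a c1 c2; pose d := (msupp c1 `|` msupp c2 `|` msupp (a *: c1 + c2))%fset.
rewrite (@linextEw _ _ d) ?(@linextEw _ c1 d) ?(@linextEw _ c2 d);
  try by move=> k kc; rewrite !inE kc ?orbT.
rewrite scaler_sumr -big_split/=; apply: eq_bigr => k _.
by rewrite mcoeffD mcoeffZ scalerDl scalerA.
Qed.

HB.instance Definition _ h :=
  GRing.isLinear.Build F {malg F[K]} V *:%R (linext h) (linext_is_linear h).

Lemma linextU h k : linext h << k >> = h k.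
Proof.
rewrite (@linextEw _ _ [fset k]%fset) ?big_seq_fset1 ?mcoeffUU ?scale1r//.
by apply/fsubsetP; exact: msuppU_le.
Qed.

Lemma eq_linear_basis (f g : {linear {malg F[K]} -> V}) :
  (forall k, f << k >> = g << k >>) -> f =1 g.
Proof.
move=> fg c; rewrite (monalgE c) !linear_sum/=; apply: eq_bigr => k _.
have -> : << c@_k *g k >> = c@_k *: << k >> :> {malg F[K]}.
  by apply/malgP => j; rewrite mcoeffZ !mcoeffU mulr_natr.
by rewrite !linearZ fg.
Qed.

Lemma linext_eta (f : {linear {malg F[K]} -> V}) c :
  linext (fun k => f << k >>) c = f c.
Proof. by apply: (eq_linear_basis (f := linext _)) => k; exact: linextU. Qed.

End Theory.

Lemma linext_comp K (V W : lmodType F) (f : {linear V -> W}) (h : K -> V) c :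
  f (linext h c) = linext (f \o h) c.
Proof.
by rewrite /linext linear_sum; apply: eq_bigr => k _; rewrite linearZ.
Qed.

Lemma eq_linext K (V : lmodType F) (h h' : K -> V) :
  h =1 h' -> linext h =1 linext h'.
Proof. by move=> hh' c; apply: eq_bigr => k _; rewrite hh'. Qed.

Lemma linextB K L (V : lmodType F) (h : K -> L -> V) a b :
  linext (fun p : K * L => h p.1 p.2) (tensor a b) =
  linext (fun k => linext (h k) b) a.
Proof.
rewrite /tensor linext_comp; apply: eq_linext => k /=.
by rewrite linext_comp; apply: eq_linext => l /=; rewrite linextU.
Qed.

Lemma linext_swap K L (V : lmodType F) (h : K -> L -> V) a b :
  linext (fun k => linext (h k) b) a =
  linext (fun l => linext (h^~ l) a) b.
Proof.
rewrite /linext; under eq_bigr do rewrite scaler_sumr.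
rewrite exchange_big; apply: eq_bigr => l _; rewrite scaler_sumr.
by apply: eq_bigr => k _; rewrite !scalerA mulrC.
Qed.

Lemma tensorUU K L (k : K) (l : L) :
  tensor << k >> << l >> = << (k, l) >> :> {malg F[(K * L)%type]}.
Proof. by rewrite /tensor !linextU. Qed.

Lemma tensor_is_linear K L (a : {malg F[K]}) :
  linear (@tensor K L a).
Proof.
have tensorE b : tensor a b = linext (fun l =>
    linext (fun k => << (k, l) >> : {malg F[(K * L)%type]}) a) b.
  exact: linext_swap.
by move=> x b b'; rewrite !tensorE linearP.
Qed.

HB.instance Definition _ K L (a : {malg F[K]}) :=
  GRing.isLinear.Build F {malg F[L]} {malg F[(K * L)%type]} *:%R (tensor a)
    (@tensor_is_linear K L a).

Lemma tensor_linextl K K' L (h : K -> {malg F[K']}) a (b : {malg F[L]}) :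
  tensor (linext h a) b = linext (fun k => tensor (h k) b) a.
Proof. by rewrite /tensor linext_comp. Qed.

Lemma tensor_mapE K L K' L' (phi : {linear {malg F[K]} -> {malg F[K']}})
    (psi : {linear {malg F[L]} -> {malg F[L']}}) a b :
  tensor_map phi psi (tensor a b) = tensor (phi a) (psi b).
Proof.
rewrite /tensor_map (linextB (fun k l => tensor (phi << k >>) (psi << l >>))).
rewrite -[in RHS](linext_eta phi a) tensor_linextl; apply: eq_linext => k.
by rewrite -[in RHS](linext_eta psi b) linext_comp.
Qed.

Lemma tensor_formE K L (chi : {linear {malg F[K]} -> F^o})
    (xi : {linear {malg F[L]} -> F^o}) a b :
  tensor_form chi xi (tensor a b) = chi a * xi b.
Proof.
rewrite /tensor_form (linextB (fun k l => chi << k >> * xi << l >> : F^o)).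
rewrite -(linext_eta chi a) /linext mulr_suml; apply: eq_bigr => k _.
rewrite -scalerAl; congr (_ *: _); rewrite -(linext_eta xi b) /linext mulr_sumr.
by apply: eq_bigr => l _; rewrite -scalerAr.
Qed.

Lemma tensor_mapU K L K' L' (phi : {malg F[K]} -> {malg F[K']})
    (psi : {malg F[L]} -> {malg F[L']}) k l :
  tensor_map phi psi << (k, l) >> = tensor (phi << k >>) (psi << l >>).
Proof. exact: linextU. Qed.

Lemma tensor_map_id K L (t : {malg F[(K * L)%type]}) : tensor_map id id t = t.
Proof.
rewrite -[RHS](linext_eta idfun); apply: eq_linext => -[k l].
exact: tensorUU.
Qed.

Lemma tensor_map_comp K L K' L' K'' L''
    (phi : {linear {malg F[K]} -> {malg F[K']}})
    (psi : {linear {malg F[L]} -> {malg F[L']}})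
    (phi' : {linear {malg F[K']} -> {malg F[K'']}})
    (psi' : {linear {malg F[L']} -> {malg F[L'']}}) t :
  tensor_map phi' psi' (tensor_map phi psi t) =
  tensor_map (phi' \o phi) (psi' \o psi) t.
Proof.
rewrite [LHS](linext_comp (linext _)); apply: eq_linext => -[k l].
exact: tensor_mapE.
Qed.

Lemma tensor_form_map K L K' L' (phi : {linear {malg F[K]} -> {malg F[K']}})
    (psi : {linear {malg F[L]} -> {malg F[L']}})
    (chi : {linear {malg F[K']} -> F^o}) (xi : {linear {malg F[L']} -> F^o}) t :
  tensor_form chi xi (tensor_map phi psi t) =
  tensor_form (chi \o phi) (xi \o psi) t.
Proof.
rewrite [LHS](linext_comp (linext _)); apply: eq_linext => -[k l].
exact: tensor_formE.
Qed.

End Free.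

HB.mixin Record isLocallyFinite (d : Order.disp_t) X of Order.POrder d X := {
  finite_interval : forall x y : X, finite_set [set z | (x <= z <= y)%O]
}.

#[short(type="locFinPOrderType")]
HB.structure Definition LocFinPOrder (d : Order.disp_t) :=
  { X of Order.POrder d X & isLocallyFinite d X }.

Section Interval.
Context {d : Order.disp_t} {X : locFinPOrderType d}.

Definition interval (x y : X) : {fset X} := fset_set [set z | (x <= z <= y)%O].

Lemma in_interval x y z : (z \in interval x y) = (x <= z <= y)%O.
Proof.
by rewrite in_fset_set ?mem_setE//; exact: finite_interval.
Qed.

Definition order_automorphism (tau : X -> X) : Prop :=
  bijective tau /\ {mono tau : x y / (x <= y)%O}.

End Interval.

Section Coalgebra.
Context {d : Order.disp_t} (X : locFinPOrderType d) (F : fieldType).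

(* The interval [x, y] is encoded by its pair of endpoints. *)
Definition itv_index := {p : X * X | (p.1 <= p.2)%O}.
HB.instance Definition _ := Choice.on itv_index.

Definition Co := {malg F[itv_index]}.
HB.instance Definition _ := GRing.Lmodule.on Co.

Definition CoCo := {malg F[(itv_index * itv_index)%type]}.
HB.instance Definition _ := GRing.Lmodule.on CoCo.

(* The basis vector [x, y] of Co; junk value 0 unless x <= y. *)
Definition itv (x y : X) : Co :=
  if insub (x, y) is Some i then << (i : itv_index) >> else 0.

Lemma itv_val (i : itv_index) : itv (val i).1 (val i).2 = << i >>.
Proof. by rewrite /itv -surjective_pairing valK. Qed.

Lemma itvP x y : (x <= y)%O ->
  exists2 i : itv_index, val i = (x, y) & itv x y = << i >>.
Proof.
move=> xy; exists (Sub (x, y) (xy : (fun p => (p.1 <= p.2)%O) (x, y))).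
  by rewrite SubK.
by rewrite /itv insubT.
Qed.

Definition Delta : Co -> CoCo := linext (fun i : itv_index =>
  \sum_(z <- interval (val i).1 (val i).2)
    tensor (itv (val i).1 z) (itv z (val i).2)).

Definition counit : Co -> F^o := linext (fun i : itv_index =>
  ((val i).1 == (val i).2)%:R : F^o).

Lemma Delta_is_linear : linear Delta. Proof. exact: linearP. Qed.
HB.instance Definition _ :=
  GRing.isLinear.Build F Co CoCo *:%R Delta Delta_is_linear.

Lemma counit_is_linear : linear counit. Proof. exact: linearP. Qed.
HB.instance Definition _ :=
  GRing.isLinear.Build F Co F^o *:%R counit counit_is_linear.

Lemma Delta_itv x y : (x <= y)%O ->
  Delta (itv x y) = \sum_(z <- interval x y) tensor (itv x z) (itv z y).
Proof. by case/itvP=> i ixy ->; rewrite /Delta linextU ixy. Qed.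

Lemma counit_itv x y : (x <= y)%O -> counit (itv x y) = (x == y)%:R.
Proof. by case/itvP=> i ixy ->; rewrite /counit linextU ixy. Qed.

Definition coalgebra_automorphism (phi : Co -> Co) : Prop :=
  [/\ linear phi, bijective phi,
      forall c, tensor_map phi phi (Delta c) = Delta (phi c)
    & forall c, counit (phi c) = counit c].

Definition AutC := {phi : Co -> Co | `[< coalgebra_automorphism phi >]}.
HB.instance Definition _ := Choice.on AutC.

Definition AutC_fun (phi : AutC) : Co -> Co := sval phi.

Lemma AutCP (phi : AutC) : coalgebra_automorphism (AutC_fun phi).
Proof. exact/asboolP/(svalP phi). Qed.

Lemma AutC_eq (phi psi : AutC) : AutC_fun phi =1 AutC_fun psi -> phi = psi.
Proof. by move=> e; apply/val_inj/funext. Qed.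

Lemma AutC_is_linear (phi : AutC) : linear (AutC_fun phi).
Proof. by have [] := AutCP phi. Qed.

HB.instance Definition _ (phi : AutC) :=
  GRing.isLinear.Build F Co Co *:%R (AutC_fun phi) (AutC_is_linear phi).

Lemma AutC_one_subproof : coalgebra_automorphism idfun.
Proof. by split=> // c; exact: tensor_map_id. Qed.

Definition AutC_one : AutC :=
  exist _ (idfun : Co -> Co) (asboolT AutC_one_subproof).

Lemma AutC_mul_subproof (phi psi : AutC) :
  coalgebra_automorphism (AutC_fun phi \o AutC_fun psi).
Proof.
have [_ bphi Dphi ephi] := AutCP phi; have [_ bpsi Dpsi epsi] := AutCP psi.
split=> [|||c/=]; last by rewrite ephi.
- exact: linearP.
- exact: bij_comp.
by move=> c; rewrite -[LHS](tensor_map_comp (AutC_fun psi) (AutC_fun psi)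
  (AutC_fun phi) (AutC_fun phi)) Dpsi Dphi.
Qed.

Definition AutC_mul (phi psi : AutC) : AutC :=
  exist _ (AutC_fun phi \o AutC_fun psi) (asboolT (AutC_mul_subproof phi psi)).

Definition AutC_inv_fun (phi : AutC) : Co -> Co :=
  let: And4 _ b _ _ := AutCP phi in sval (bijective_inverse b).

Lemma AutC_inv_funK (phi : AutC) :
  cancel (AutC_fun phi) (AutC_inv_fun phi) /\
  cancel (AutC_inv_fun phi) (AutC_fun phi).
Proof.
by rewrite /AutC_inv_fun; case: (AutCP phi) => _ b _ _; case: bijective_inverse.
Qed.

Lemma AutC_inv_is_linear (phi : AutC) : linear (AutC_inv_fun phi).
Proof.
have [K K'] := AutC_inv_funK phi => a c c'.
by apply: (can_inj K); rewrite K' (AutC_is_linear phi) !K'.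
Qed.

HB.instance Definition _ (phi : AutC) :=
  GRing.isLinear.Build F Co Co *:%R (AutC_inv_fun phi) (AutC_inv_is_linear phi).

Lemma AutC_inv_subproof (phi : AutC) :
  coalgebra_automorphism (AutC_inv_fun phi).
Proof.
have [_ _ Dphi ephi] := AutCP phi; have [K K'] := AutC_inv_funK phi.
split=> [|||c]; last by rewrite -ephi K'.
- exact: linearP.
- by exists (AutC_fun phi).
move=> c; rewrite -[in LHS](K' c) -Dphi tensor_map_comp.
by rewrite (_ : _ \o _ = id) ?tensor_map_id//; apply/funext.
Qed.

Definition AutC_inv (phi : AutC) : AutC :=
  exist _ (AutC_inv_fun phi) (asboolT (AutC_inv_subproof phi)).

Lemma AutC_mulA : associative AutC_mul.
Proof. by move=> f g h; exact: AutC_eq. Qed.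
Lemma AutC_mul1 : left_id AutC_one AutC_mul.
Proof. by move=> f; exact: AutC_eq. Qed.
Lemma AutC_mulr1 : right_id AutC_one AutC_mul.
Proof. by move=> f; exact: AutC_eq. Qed.
Lemma AutC_mulV : left_inverse AutC_one AutC_inv AutC_mul.
Proof. by move=> f; have [K K'] := AutC_inv_funK f; exact: AutC_eq. Qed.
Lemma AutC_mulrV : right_inverse AutC_one AutC_inv AutC_mul.
Proof. by move=> f; have [K K'] := AutC_inv_funK f; exact: AutC_eq. Qed.

HB.instance Definition _ := isGroup.Build AutC
  AutC_mulA AutC_mul1 AutC_mulr1 AutC_mulV AutC_mulrV.

Definition incalg_pred : {pred X -> X -> F^o} :=
  [pred f : X -> X -> F^o | `[< forall x y, ~~ (x <= y)%O -> f x y = 0 >]].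

Lemma incalg_submod_closed : submod_closed incalg_pred.
Proof.
split=> [|a f g /asboolP f0 /asboolP g0]; apply/asboolP => // x y xy.
by rewrite !fctE f0// g0// scaler0 addr0.
Qed.

HB.instance Definition _ :=
  GRing.isSubmodClosed.Build F (X -> X -> F^o) incalg_pred incalg_submod_closed.

Definition incalg := {f : X -> X -> F^o | incalg_pred f}.
HB.instance Definition _ := SubChoice.on incalg.
HB.instance Definition _ := [SubChoice_isSubLmodule of incalg by <:].

Definition incalg_fun (f : incalg) : X -> X -> F := sval f.
Local Coercion incalg_fun : incalg >-> Funclass.

Lemma mk_incalg_subproof (h : X -> X -> F) :
  incalg_pred (fun x y => if (x <= y)%O then h x y else 0).
Proof. by apply/asboolP => x y /negbTE ->. Qed.

Definition mk_incalg (h : X -> X -> F) : incalg :=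
  exist (fun f => is_true (incalg_pred f))
    (fun x y => if (x <= y)%O then h x y else 0) (mk_incalg_subproof h).

Lemma mk_incalgE h x y : (x <= y)%O -> mk_incalg h x y = h x y.
Proof. by rewrite /incalg_fun/= => ->. Qed.

Lemma incalg0 (f : incalg) x y : ~~ (x <= y)%O -> f x y = 0.
Proof. by have /asboolP := svalP f; exact. Qed.

Lemma incalgP (f g : incalg) :
  (forall x y, (x <= y)%O -> f x y = g x y) -> f = g.
Proof.
move=> fg; apply/val_inj/funext => x; apply/funext => y.
have [xy|xy] := boolP (x <= y)%O; first exact: fg.
by rewrite -[LHS]/(f x y) -[RHS]/(g x y) !incalg0.
Qed.

Lemma incalgD (f g : incalg) x y : incalg_fun (f + g) x y = f x y + g x y.
Proof. by []. Qed.
Lemma incalgZ a (f : incalg) x y : incalg_fun (a *: f) x y = a * f x y.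
Proof. by []. Qed.

Definition incalg_one : incalg := mk_incalg (fun x y => (x == y)%:R).

Definition incalg_mul (f g : incalg) : incalg :=
  mk_incalg (fun x y => \sum_(z <- interval x y) f x z * g z y).

Lemma incalg_mulA : associative incalg_mul.
Proof.
move=> f g h; apply: incalgP => x y xy; rewrite !mk_incalgE//.
transitivity (\sum_(z <- interval x y) \sum_(t <- interval x y | (z <= t)%O)
    f x z * (g z t * h t y)).
  rewrite big_seq [RHS]big_seq; apply: eq_bigr => z; rewrite in_interval => /andP[xz zy].
  rewrite mk_incalgE// mulr_sumr -[RHS]big_filter; apply: perm_big.
  apply: uniq_perm; rewrite ?filter_uniq ?fset_uniq// => t.
  rewrite mem_filter !in_interval; apply/andP/and3P => [[]|[zt _ ty]]//.
  by move=> zt ty; split=> //; exact: le_trans zt.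
transitivity (\sum_(t <- interval x y) \sum_(z <- interval x y | (z <= t)%O)
    f x z * (g z t * h t y)); last first.
  rewrite big_seq [RHS]big_seq; apply: eq_bigr => z; rewrite in_interval => /andP[xz zy].
  rewrite mk_incalgE// mulr_suml -[LHS]big_filter.
  under eq_bigr do rewrite mulrA.
  apply: perm_big.
  apply: uniq_perm; rewrite ?filter_uniq ?fset_uniq// => t.
  rewrite mem_filter !in_interval; apply/and3P/andP => [[]|[xt tz]]//.
  by split=> //; exact: le_trans zy.
by rewrite (exchange_big_dep xpredT).
Qed.

Lemma incalg_mul1 : left_id incalg_one incalg_mul.
Proof.
move=> f; apply: incalgP => x y xy; rewrite mk_incalgE// /incalg_one.
rewrite (big_fsetD1 x) ?in_interval ?lexx// mk_incalgE// eqxx mul1r.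
rewrite big_seq big1 => [|z]; first exact: addr0.
rewrite !inE in_interval => /and3P[zx xz _].
by rewrite mk_incalgE// eq_sym (negbTE zx) mul0r.
Qed.

Lemma incalg_mulr1 : right_id incalg_one incalg_mul.
Proof.
move=> f; apply: incalgP => x y xy; rewrite mk_incalgE// /incalg_one.
rewrite (big_fsetD1 y) ?in_interval ?lexx ?xy// mk_incalgE// eqxx mulr1.
rewrite big_seq big1 => [|z]; first exact: addr0.
rewrite !inE in_interval => /and3P[zx _ zy].
by rewrite mk_incalgE// (negbTE zx) mulr0.
Qed.

Lemma incalg_mulDl : left_distributive incalg_mul +%R.
Proof.
move=> f g h; apply: incalgP => x y xy; rewrite incalgD !mk_incalgE//.
by rewrite -big_split; apply: eq_bigr => z _; rewrite incalgD mulrDl.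
Qed.

Lemma incalg_mulDr : right_distributive incalg_mul +%R.
Proof.
move=> f g h; apply: incalgP => x y xy; rewrite incalgD !mk_incalgE//.
by rewrite -big_split; apply: eq_bigr => z _; rewrite incalgD mulrDr.
Qed.

HB.instance Definition _ := GRing.Zmodule_isPzRing.Build incalg
  incalg_mulA incalg_mul1 incalg_mulr1 incalg_mulDl incalg_mulDr.

Definition dual_pred : {pred Co -> F^o} :=
  [pred chi : Co -> F^o | `[< linear chi >]].

Lemma dual_submod_closed : submod_closed dual_pred.
Proof.
split=> [|a chi xi /asboolP lchi /asboolP lxi].
  by apply/asboolP => a c c'; rewrite /= scaler0 addr0.
apply/asboolP => b c c' /=.
rewrite !fctE lchi lxi !scalerDr !scalerA [b * a]mulrC.
by rewrite -!addrA; congr (_ + _); rewrite addrCA.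
Qed.

HB.instance Definition _ :=
  GRing.isSubmodClosed.Build F (Co -> F^o) dual_pred dual_submod_closed.

Definition dual := {chi : Co -> F^o | dual_pred chi}.
HB.instance Definition _ := SubChoice.on dual.
HB.instance Definition _ := [SubChoice_isSubLmodule of dual by <:].


Definition dual_fun (chi : dual) : Co -> F^o := sval chi.
Local Coercion dual_fun : dual >-> Funclass.

Lemma dual_is_linear (chi : dual) : linear (dual_fun chi).
Proof. exact/asboolP/(svalP chi). Qed.
HB.instance Definition _ (chi : dual) :=
  GRing.isLinear.Build F Co F^o *:%R (dual_fun chi) (dual_is_linear chi).

Definition mk_dual (h : Co -> F^o) (lh : linear h) : dual :=
  exist (fun chi => is_true (dual_pred chi)) h (asboolT lh).

Lemma dualP (chi xi : dual) :
  (forall x y, (x <= y)%O -> chi (itv x y) = xi (itv x y)) -> chi = xi.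
Proof.
move=> e; apply/val_inj/funext.
apply: (eq_linear_basis (f := dual_fun chi) (g := dual_fun xi)) => i.
by rewrite -itv_val; exact: (e _ _ (valP i)).
Qed.

Definition dual_one : dual := mk_dual counit_is_linear.

Lemma dual_mul_subproof (chi xi : dual) :
  linear (tensor_form chi xi \o Delta).
Proof. by move=> a c c'; rewrite /= Delta_is_linear /tensor_form linearP. Qed.

Definition dual_mul (chi xi : dual) : dual :=
  mk_dual (dual_mul_subproof chi xi).

Lemma dual_mulE (chi xi : dual) x y : (x <= y)%O ->
  dual_mul chi xi (itv x y) =
  \sum_(z <- interval x y) chi (itv x z) * xi (itv z y).
Proof.
move=> xy; rewrite [LHS]/(tensor_form chi xi (Delta _)) Delta_itv//.
rewrite [LHS](linear_sum (linext _)); apply: eq_bigr => z _.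
exact: tensor_formE.
Qed.

Definition Phi (chi : dual) : incalg := mk_incalg (fun x y => chi (itv x y)).

Lemma Psi_subproof (f : incalg) :
  linear (linext (fun i : itv_index => f (val i).1 (val i).2 : F^o)).
Proof. exact: linearP. Qed.

Definition Psi (f : incalg) : dual := mk_dual (Psi_subproof f).

Lemma PhiE (chi : dual) x y : (x <= y)%O -> Phi chi x y = chi (itv x y).
Proof. exact: mk_incalgE. Qed.

Lemma PsiE (f : incalg) x y : (x <= y)%O -> Psi f (itv x y) = f x y.
Proof.
case/itvP=> i ixy ->.
by rewrite [LHS](linextU (fun i : itv_index => f (val i).1 (val i).2 : F^o)) ixy.
Qed.

Lemma PhiK : cancel Phi Psi.
Proof. by move=> chi; apply: dualP => x y xy; rewrite PsiE// PhiE. Qed.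

Lemma PsiK : cancel Psi Phi.
Proof. by move=> f; apply: incalgP => x y xy; rewrite PhiE// PsiE. Qed.

Lemma Phi_is_linear : linear Phi.
Proof.
by move=> a chi xi; apply: incalgP => x y xy; rewrite incalgD incalgZ !PhiE.
Qed.

Lemma Phi1 : Phi dual_one = 1.
Proof.
apply: incalgP => x y xy; rewrite PhiE// [RHS]mk_incalgE//.
exact: counit_itv.
Qed.

Lemma PhiM : {morph Phi : chi xi / dual_mul chi xi >-> chi * xi}.
Proof.
move=> chi xi; apply: incalgP => x y xy; rewrite PhiE// [RHS]mk_incalgE//.
rewrite dual_mulE// big_seq [RHS]big_seq; apply: eq_bigr => z.
by rewrite in_interval => /andP[xz zy]; rewrite !PhiE.
Qed.

Lemma PhiD : {morph Phi : chi xi / chi + xi}.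
Proof. by move=> chi xi; have := Phi_is_linear 1 chi xi; rewrite !scale1r. Qed.

Lemma dual_mulA : associative dual_mul.
Proof. by move=> a b c; apply: (can_inj PhiK); rewrite !PhiM mulrA. Qed.
Lemma dual_mul1 : left_id dual_one dual_mul.
Proof. by move=> a; apply: (can_inj PhiK); rewrite PhiM Phi1 mul1r. Qed.
Lemma dual_mulr1 : right_id dual_one dual_mul.
Proof. by move=> a; apply: (can_inj PhiK); rewrite PhiM Phi1 mulr1. Qed.
Lemma dual_mulDl : left_distributive dual_mul +%R.
Proof.
by move=> a b c; apply: (can_inj PhiK); rewrite !(PhiM, PhiD) mulrDl.
Qed.
Lemma dual_mulDr : right_distributive dual_mul +%R.
Proof.
by move=> a b c; apply: (can_inj PhiK); rewrite !(PhiM, PhiD) mulrDr.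
Qed.

HB.instance Definition _ := GRing.Zmodule_isPzRing.Build dual
  dual_mulA dual_mul1 dual_mulr1 dual_mulDl dual_mulDr.

Section DualMap.
Variable phi : {linear Co -> Co}.

Lemma dual_map_subproof (chi : dual) : linear (chi \o phi).
Proof. exact: linearP. Qed.

Definition dual_map (chi : dual) : dual := mk_dual (dual_map_subproof chi).

Definition Theta_end : incalg -> incalg := Phi \o dual_map \o Psi.

End DualMap.

Definition algebra_automorphism (theta : incalg -> incalg) : Prop :=
  [/\ linear theta, GRing.monoid_morphism theta & bijective theta].

Definition AutA := {theta : incalg -> incalg | `[< algebra_automorphism theta >]}.
HB.instance Definition _ := Choice.on AutA.

Definition AutA_fun (theta : AutA) : incalg -> incalg := sval theta.

Lemma AutAP (theta : AutA) : algebra_automorphism (AutA_fun theta).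
Proof. exact/asboolP/(svalP theta). Qed.

Lemma AutA_eq (f g : AutA) : AutA_fun f =1 AutA_fun g -> f = g.
Proof. by move=> e; apply/val_inj/funext. Qed.

Lemma AutA_one_subproof : algebra_automorphism idfun.
Proof. by split. Qed.

Definition AutA_one : AutA :=
  exist _ (idfun : incalg -> incalg) (asboolT AutA_one_subproof).

Lemma AutA_mul_subproof (f g : AutA) :
  algebra_automorphism (AutA_fun f \o AutA_fun g).
Proof.
have [lf [f1 fM] bf] := AutAP f; have [lg [g1 gM] bg] := AutAP g.
split; last exact: bij_comp.
  by move=> a u v; rewrite /= lg lf.
by split=> [|u v]; rewrite /= ?g1 ?f1// gM fM.
Qed.

Definition AutA_mul (f g : AutA) : AutA :=
  exist _ (AutA_fun f \o AutA_fun g) (asboolT (AutA_mul_subproof f g)).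

Definition AutA_inv_fun (f : AutA) : incalg -> incalg :=
  let: And3 _ _ b := AutAP f in sval (bijective_inverse b).

Lemma AutA_inv_funK (f : AutA) :
  cancel (AutA_fun f) (AutA_inv_fun f) /\ cancel (AutA_inv_fun f) (AutA_fun f).
Proof.
by rewrite /AutA_inv_fun; case: (AutAP f) => _ _ b; case: bijective_inverse.
Qed.

Lemma AutA_inv_subproof (f : AutA) : algebra_automorphism (AutA_inv_fun f).
Proof.
have [lf [f1 fM] _] := AutAP f; have [K K'] := AutA_inv_funK f.
split; last by exists (AutA_fun f).
  by move=> a u v; apply: (can_inj K); rewrite lf !K'.
by split=> [|u v]; apply: (can_inj K); rewrite ?fM !K' ?f1.
Qed.

Definition AutA_inv (f : AutA) : AutA :=
  exist _ (AutA_inv_fun f) (asboolT (AutA_inv_subproof f)).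

Lemma AutA_mulA : associative AutA_mul.
Proof. by move=> f g h; exact: AutA_eq. Qed.
Lemma AutA_mul1 : left_id AutA_one AutA_mul.
Proof. by move=> f; exact: AutA_eq. Qed.
Lemma AutA_mulr1 : right_id AutA_one AutA_mul.
Proof. by move=> f; exact: AutA_eq. Qed.
Lemma AutA_mulV : left_inverse AutA_one AutA_inv AutA_mul.
Proof. by move=> f; have [K K'] := AutA_inv_funK f; exact: AutA_eq. Qed.
Lemma AutA_mulrV : right_inverse AutA_one AutA_inv AutA_mul.
Proof. by move=> f; have [K K'] := AutA_inv_funK f; exact: AutA_eq. Qed.

HB.instance Definition _ := isGroup.Build AutA
  AutA_mulA AutA_mul1 AutA_mulr1 AutA_mulV AutA_mulrV.

Lemma dual_mapM (phi : AutC) :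
  {morph dual_map (AutC_fun phi) : chi xi / chi * xi}.
Proof.
move=> chi xi; have [_ _ D _] := AutCP phi; apply/val_inj/funext => c.
transitivity (tensor_form chi xi (Delta (AutC_fun phi c))) => //.
by rewrite -D tensor_form_map.
Qed.

Lemma dual_map1 (phi : AutC) : dual_map (AutC_fun phi) 1 = 1.
Proof. by have [_ _ _ e] := AutCP phi; exact/val_inj/funext. Qed.

Lemma Psi1 : Psi 1 = 1.
Proof. by apply: (can_inj PhiK); rewrite PsiK Phi1. Qed.

Lemma PsiM : {morph Psi : f g / f * g}.
Proof. by move=> f g; apply: (can_inj PhiK); rewrite PhiM !PsiK. Qed.

Lemma Psi_is_linear : linear Psi.
Proof.
by move=> a f g; apply: (can_inj PhiK); rewrite Phi_is_linear !PsiK.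
Qed.

Lemma Theta_endK (phi psi : {linear Co -> Co}) :
  cancel phi psi -> cancel (Theta_end psi) (Theta_end phi).
Proof.
move=> K f; rewrite /Theta_end /= PhiK -[RHS]PsiK; congr Phi.
by apply/val_inj/funext => c; rewrite /= /dual_fun/= K.
Qed.

Lemma Theta_subproof (phi : AutC) :
  algebra_automorphism (Theta_end (AutC_fun phi)).
Proof.
have [K K'] := AutC_inv_funK phi; split.
- move=> a f g; rewrite /Theta_end /= Psi_is_linear -Phi_is_linear.
  by congr Phi; exact/val_inj.
- split=> [|f g]; first by rewrite /Theta_end /= Psi1 dual_map1 Phi1.
  by rewrite /Theta_end /= PsiM dual_mapM PhiM.
by exists (Theta_end (AutC_inv_fun phi)); exact: Theta_endK.
Qed.

Definition Theta (phi : AutC) : AutA :=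
  exist _ (Theta_end (AutC_fun phi)) (asboolT (Theta_subproof phi)).

Definition M1 : set incalg := [set f | forall x, f x x = 0].

Definition In1AutA : set AutA :=
  [set theta | exists2 g, M1 g & inner_by (1 + g) (AutA_fun theta)].

Definition InAutC : set AutC :=
  [set nu | exists v : dual, inner_by v (dual_map (AutC_fun nu))].

Definition In1AutC : set AutC := Theta @^-1` In1AutA.

Definition multiplicative_system (m : X -> X -> F) : Prop :=
  (forall x y, (x < y)%O -> m x y != 0) /\
  (forall x z y, (x < z)%O -> (z < y)%O -> m x y = m x z * m z y).

Definition MultC : set AutC :=
  [set lambda | exists m, [/\ multiplicative_system m,
     forall x y, (x < y)%O -> AutC_fun lambda (itv x y) = m x y *: itv x y
   & forall x, AutC_fun lambda (itv x x) = itv x x]].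

Definition AutCX : set AutC :=
  [set phi | exists2 tau : X -> X, order_automorphism tau &
     forall x y, (x <= y)%O -> AutC_fun phi (itv x y) = itv (tau x) (tau y)].

End Coalgebra.

Arguments Theta {d} X F.
Arguments M1 {d} X F.
Arguments In1AutA {d} X F.
Arguments InAutC {d} X F.
Arguments In1AutC {d} X F.
Arguments MultC {d} X F.
Arguments AutCX {d} X F.

(* Main.v *)
Require Import Defs.
From HB Require Import structures.
From mathcomp Require Import all_boot all_order all_algebra finmap.
From mathcomp Require Import boolp classical_sets.
From mathcomp Require Import monalg.

(** The whole theorem rests on one structure result about the algebra A of
    functions f(x, y) supported on x <= y, valid for any algebra automorphism
    theta of A, with no continuity assumption:
      theta(f) = w * (m(x, y) f(s x, s y))_(x, y) * u,
    where u has diagonal 1 and inverse w, m is a nowhere zero multiplicative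
    weight, and s is an order automorphism ([AutA_decomposition]).

    To obtain it, let e_x be the matrix unit at (x, x).  Since e_x A e_x is
    one-dimensional, so is p A p for the idempotent p = theta(e_x).  A nonzero
    idempotent has a nonzero diagonal entry, because an element with zero
    diagonal is nilpotent on every finite interval; two nonzero diagonal
    entries would make p A p too large.  So p has the diagonal of a single e_y,
    and y = t(x) turns out to be a permutation of X with inverse s.  The element
    u whose row y is row y of theta(e_(s y)) has diagonal 1, is therefore
    invertible, and conjugates every theta(e_x) into e_(t x).  After this
    conjugation each matrix unit at (x, y) goes to a multiple of the one at
    (t x, t y), which yields both the monotonicity of t and the weights.

    The right-hand side of the formula involves, at a given (x, y), finitely
    many values of f only.  Hence theta is the transpose of a linear map of C,
    read off from the formula; applying this also to the inverse of theta, one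
    gets an inverse of that linear map.  As the functionals f of A separate the
    points of C and the products of two of them those of C (x) C, a linear map
    whose transpose is an algebra automorphism respects comultiplication and
    counit.  So Theta is onto ([Theta_surj]); it is injective for the same
    separation reason.

    For the semidirect products, everything is computed in A through Theta,
    where Mult C becomes f |-> m f, Aut_C X becomes f |-> f(s x, s y), and the
    inner groups become conjugations.  The map sending an automorphism to its
    permutation s of X is, up to the side of composition, a homomorphism onto
    the order automorphisms which Aut_C X splits.  Its kernel consists of the
    automorphisms preserving the diagonal of every f, and the structure
    formula with s = id shows that the kernel equals both In_1 . Mult and
    In . Mult.  An element of In_1 and Mult at once is conjugation by some v
    with diagonal 1 that commutes with all e_x; then v is diagonal, so v = 1. *)

Set Implicit Arguments.
Unset Strict Implicit.
Unset Printing Implicit Defensive.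

Import Order.TTheory GRing.Theory.
Local Open Scope classical_set_scope.
Local Open Scope ring_scope.

(** * The incidence algebra *)

Section IncidenceAlgebra.
Context {d : Order.disp_t} {X : locFinPOrderType d} {F : fieldType}.
Local Notation A := (incalg X F).
Local Notation interval := Defs.interval.
Local Coercion incalg_fun : incalg >-> Funclass.
Implicit Types (f g h u v w : A) (x y z : X).

Lemma interval_eq0 x y : ~~ (x <= y)%O -> interval x y = fset0.
Proof.
move=> xy; apply/fsetP => z; rewrite in_interval !inE.
by apply: contraNF xy => /andP[xz zy]; exact: le_trans zy.
Qed.

Lemma interval_refl x : interval x x = [fset x]%fset.
Proof. by apply/fsetP => z; rewrite in_interval !inE eq_le andbC. Qed.

Lemma incalgM f g x y :
  incalg_fun (f * g) x y = \sum_(z <- interval x y) f x z * g z y.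
Proof.
have [xy|xy] := boolP (x <= y)%O; first by rewrite [LHS]mk_incalgE.
by rewrite incalg0// interval_eq0// big_seq_fset0.
Qed.

Lemma incalg1 x y : incalg_fun (1 : A) x y = (x == y)%:R.
Proof.
have [xy|xy] := boolP (x <= y)%O; first exact: mk_incalgE.
by rewrite incalg0//; case: eqP xy => // ->; rewrite lexx.
Qed.

Lemma incalgN f x y : incalg_fun (- f) x y = - f x y.
Proof. by []. Qed.

Lemma incalg_sum (I : Type) (r : seq I) (G : I -> A) x y :
  incalg_fun (\sum_(i <- r) G i) x y = \sum_(i <- r) G i x y.
Proof. by elim/big_rec2: _ => // i a b _ <-; rewrite incalgD. Qed.

Lemma incalgM_diag f g x : incalg_fun (f * g) x x = f x x * g x x.
Proof. by rewrite incalgM interval_refl big_seq_fset1. Qed.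

Lemma incalg_scalerAl a f g : a *: f * g = a *: (f * g).
Proof.
apply: incalgP => x y _; rewrite incalgZ !incalgM mulr_sumr.
by apply: eq_bigr => z _; rewrite incalgZ mulrA.
Qed.

Lemma incalg_scalerAr a f g : f * (a *: g) = a *: (f * g).
Proof.
apply: incalgP => x y _; rewrite incalgZ !incalgM mulr_sumr.
by apply: eq_bigr => z _; rewrite incalgZ mulrCA.
Qed.

(** The matrix unit at (x, y), which degenerates to 0 unless x <= y. *)
Definition munit x y : A := mk_incalg (fun a b => ((a == x) && (b == y))%:R).

Lemma munitE x y a b : (x <= y)%O ->
  munit x y a b = ((a == x) && (b == y))%:R.
Proof.
move=> xy; have [ab|ab] := boolP (a <= b)%O; first exact: mk_incalgE.
rewrite incalg0//; case: eqP => [ax|//]; case: eqP => [bY|//].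
by rewrite ax bY xy in ab.
Qed.

Lemma munitM x y f a b : (x <= y)%O ->
  incalg_fun (munit x y * f) a b = (a == x)%:R * f y b.
Proof.
move=> xy; rewrite incalgM; have [->|ax] := eqVneq a x; last first.
  by rewrite big1 ?mul0r// => z _; rewrite munitE// (negbTE ax) mul0r.
rewrite mul1r; have [yb|yb] := boolP (y <= b)%O; last first.
  rewrite [RHS]incalg0// big1// => z _; rewrite munitE// eqxx /=.
  by case: eqP => [->|_]; rewrite ?mul0r// incalg0// mulr0.
rewrite (big_fsetD1 y) ?in_interval ?xy// munitE// !eqxx mul1r.
rewrite big_seq big1 => [|z]; first exact: addr0.
rewrite !inE => /andP[zy _].
by rewrite munitE// (negbTE zy) andbF mul0r.
Qed.

Lemma Mmunit x y f a b : (x <= y)%O ->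
  incalg_fun (f * munit x y) a b = f a x * (b == y)%:R.
Proof.
move=> xy; rewrite incalgM; have [->|bY] := eqVneq b y; last first.
  by rewrite big1 ?mulr0// => z _; rewrite munitE// (negbTE bY) andbF mulr0.
rewrite mulr1; have [ax|ax] := boolP (a <= x)%O; last first.
  rewrite [RHS]incalg0// big1// => z _; rewrite munitE// eqxx andbT.
  by case: eqP => [->|_]; rewrite ?mulr0// incalg0// mul0r.
rewrite (big_fsetD1 x) ?in_interval ?ax// munitE// !eqxx mulr1.
rewrite big_seq big1 => [|z]; first exact: addr0.
rewrite !inE => /andP[zx _].
by rewrite munitE// (negbTE zx) mulr0.
Qed.

Lemma MmunitM z f g x y :
  incalg_fun (f * munit z z * g) x y = f x z * g z y.
Proof.
have [xy|xy] := boolP (x <= y)%O; last first.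
  rewrite incalg0//; have [xz|xz] := boolP (x <= z)%O; last by rewrite incalg0 ?mul0r.
  rewrite [g _ _]incalg0 ?mulr0//.
  by apply: contraNN xy; exact: le_trans.
rewrite -mulrA incalgM.
under eq_bigr do rewrite munitM// mulrCA.
have [zy|zy] := boolP (z <= y)%O; last first.
  by rewrite [g _ _]incalg0// mulr0 big1// => t _; rewrite !mulr0.
have [xz|xz] := boolP (x <= z)%O; last first.
  rewrite [f x z]incalg0// mul0r big_seq big1// => t; rewrite in_interval => /andP[xt _].
  by case: eqP xt => [->|]; rewrite ?mul0r// (negbTE xz).
rewrite (big_fsetD1 z) ?in_interval ?xz// eqxx mul1r.
rewrite big_seq big1 => [|t]; first exact: addr0.
by rewrite !inE => /andP[/negbTE-> _]; rewrite mul0r.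
Qed.

Lemma munitMmunit x f y : munit x x * f * munit y y = f x y *: munit x y.
Proof.
apply: incalgP => a b ab; rewrite incalgZ Mmunit// munitM//.
have [xy|xy] := boolP (x <= y)%O.
  by rewrite munitE// -mulrA mulrCA -natrM mulnb.
by rewrite incalg0// mulr0 !mul0r.
Qed.

Lemma munit_comp x z y : (x <= z)%O -> (z <= y)%O ->
  munit x z * munit z y = munit x y.
Proof.
move=> xz zy; apply: incalgP => a b _.
by rewrite munitM// !munitE ?(le_trans xz)// eqxx -natrM mulnb.
Qed.

Lemma munit_neq0 x y : (x <= y)%O -> munit x y != 0.
Proof.
move=> xy; apply/eqP => /(congr1 (fun f => incalg_fun f x y)).
by rewrite munitE// !eqxx => /eqP; rewrite oner_eq0.
Qed.

Lemma interval_ltn_card x y z : (x < z)%O -> (x <= y)%O ->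
  (#|` interval z y| < #|` interval x y|)%N.
Proof.
move=> xz xy; apply: fproper_ltn_card; rewrite fproperE; apply/andP; split.
  apply/fsubsetP => t; rewrite !in_interval => /andP[zt ->].
  by rewrite (le_trans (ltW xz) zt).
apply/negP => /fsubsetP/(_ x); rewrite !in_interval lexx xy => /(_ isT).
by rewrite lt_geF.
Qed.

(** Each factor of a power of f makes a strict step up in the poset, and an
    interval with n elements leaves room for fewer than n such steps. *)
Lemma M1_expr f n x y : M1 X F f -> (#|` interval x y| <= n)%N ->
  incalg_fun (f ^+ n) x y = 0.
Proof.
move=> f0; elim: n x y => [|n IHn] x y cxy.
  apply: incalg0; apply: contraTN cxy => xy; rewrite -ltnNge cardfs_gt0.
  by apply/fset0Pn; exists x; rewrite in_interval lexx.
rewrite exprS incalgM big_seq big1// => z; rewrite in_interval => /andP[xz zy].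
have [<-|xNz] := eqVneq x z; first by rewrite f0 mul0r.
rewrite IHn ?mulr0// -ltnS; apply: leq_trans cxy; apply: interval_ltn_card.
  by rewrite lt_neqAle xNz.
exact: le_trans zy.
Qed.

Lemma idempotent_M1_eq0 p : p * p = p -> M1 X F p -> p = 0.
Proof.
move=> pp p0; have pX n : p ^+ n.+1 = p.
  by elim: n => [|n IHn]; rewrite ?expr1// exprS IHn.
by apply: incalgP => x y _; rewrite -(pX #|` interval x y|) M1_expr.
Qed.

(** This locality is what allows an inverse to be pieced together from different
    truncations of a geometric series on different intervals. *)
Lemma incalg_eq_interval f f' g g' x y :
  (forall z, (x <= z)%O -> (z <= y)%O -> f x z = f' x z) ->
  (forall z, (x <= z)%O -> (z <= y)%O -> g z y = g' z y) ->
  incalg_fun (f * g) x y = incalg_fun (f' * g') x y.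
Proof.
move=> ff' gg'; rewrite !incalgM big_seq [RHS]big_seq; apply: eq_bigr => z.
by rewrite in_interval => /andP[xz zy]; rewrite ff' ?gg'.
Qed.

(** The inverse of u = 1 - g is the geometric series in g, which terminates on
    every interval by nilpotency, though not uniformly when X is infinite. *)
Lemma unipotent_invertible u : (forall x, u x x = 1) ->
  exists w, w * u = 1 /\ u * w = 1.
Proof.
move=> u1; pose g := 1 - u.
have g0 : M1 X F g by move=> x; rewrite incalgD incalgN u1 incalg1 eqxx subrr.
have uE : u = 1 - g by rewrite /g opprB addrCA subrr addr0.
pose geo n : incalg X F := \sum_(i < n) g ^+ i.
pose w : A := mk_incalg (fun x y => incalg_fun (geo #|` interval x y|) x y).
have geoE n x y : (#|` interval x y| <= n)%N -> geo n x y = geo #|` interval x y| x y.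
  move=> /subnKC <-; rewrite /geo !incalg_sum big_split_ord/=.
  by rewrite [X in _ + X]big1 ?addr0// => i _; rewrite M1_expr// leq_addr.
have wE n x y : (x <= y)%O -> (#|` interval x y| <= n)%N -> w x y = geo n x y.
  by move=> xy le_n; rewrite mk_incalgE// geoE.
have sub_card x y a b : (x <= a)%O -> (b <= y)%O ->
    (#|` interval a b| <= #|` interval x y|)%N.
  move=> xa yb; apply: fsubset_leq_card; apply/fsubsetP => t.
  rewrite !in_interval => /andP[at_ tb].
  by rewrite (le_trans xa at_) (le_trans tb yb).
have geoME n : geo n * u = 1 - g ^+ n.
  rewrite uE /geo; elim: n => [|n IHn]; first by rewrite big_ord0 mul0r expr0 subrr.
  by rewrite big_ord_recr/= mulrDl IHn mulrBr mulr1 -exprSr addrA subrK.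
have MgeoE n : u * geo n = 1 - g ^+ n.
  rewrite uE /geo; elim: n => [|n IHn]; first by rewrite big_ord0 mulr0 expr0 subrr.
  by rewrite big_ord_recr/= mulrDr IHn mulrBl mul1r -exprS addrA subrK.
exists w; split; apply: incalgP => x y xy; pose n := #|` interval x y|.
  transitivity (incalg_fun (geo n * u) x y); last first.
    by rewrite geoME incalgD incalgN M1_expr// subr0.
  by apply: incalg_eq_interval => // z xz zy; rewrite (wE n)// sub_card.
transitivity (incalg_fun (u * geo n) x y); last first.
  by rewrite MgeoE incalgD incalgN M1_expr// subr0.
by apply: incalg_eq_interval => // z xz zy; rewrite (wE n)// sub_card.
Qed.

End IncidenceAlgebra.

(** * Automorphisms of the incidence algebra *)

Section AlgebraAutomorphisms.
Context {d : Order.disp_t} {X : locFinPOrderType d} {F : fieldType}.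
Local Notation A := (incalg X F).
Local Coercion incalg_fun : incalg >-> Funclass.
Local Coercion AutA_fun : AutA >-> Funclass.
Implicit Types (f g h u v w : A) (x y z : X) (theta : AutA X F).

Lemma AutA_linear theta a f g : theta (a *: f + g) = a *: theta f + theta g.
Proof. by have [l _ _] := AutAP theta; exact: l. Qed.

Lemma AutAM theta f g : theta (f * g) = theta f * theta g.
Proof. by have [_ [_ m] _] := AutAP theta; exact: m. Qed.

Lemma AutA1 theta : theta 1 = 1.
Proof. by have [_ [m _] _] := AutAP theta; exact: m. Qed.

Lemma AutA_inj theta : injective theta.
Proof. by have [_ _ b] := AutAP theta; exact: bij_inj. Qed.

Lemma AutA0 theta : theta 0 = 0.
Proof.
have /(congr1 (fun f => f - theta 0)) := AutA_linear theta 1 0 0.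
by rewrite scaler0 addr0 scale1r subrr addrK.
Qed.

Lemma AutAZ theta a f : theta (a *: f) = a *: theta f.
Proof. by have := AutA_linear theta a f 0; rewrite AutA0 !addr0. Qed.

(** The idempotent p = theta(e_x) inherits from e_x that p A p is
    one-dimensional, which confines its diagonal to a single entry. *)
Lemma AutA_munit_diag theta x :
  exists y, forall z, theta (munit x x) z z = (z == y)%:R.
Proof.
set p := theta (munit x x).
have pp : p * p = p by rewrite -AutAM munit_comp.
have pz z : p z z = 0 \/ p z z = 1.
  have /(congr1 (fun f => incalg_fun f z z)) := pp.
  rewrite incalgM_diag => /eqP; rewrite -subr_eq0 -[X in _ - X]mulr1 -mulrBr.
  by rewrite mulf_eq0 subr_eq0 => /orP[]/eqP; [left|right].
have [y py] : exists y, p y y = 1.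
  apply: contrapT => npy; have : p = 0.
    apply: idempotent_M1_eq0 => // z; case: (pz z) => // pz1.
    by case: npy; exists z.
  rewrite -(AutA0 theta) => /AutA_inj/eqP; apply/negP; exact: munit_neq0.
exists y => z; have [->//|zy] := eqVneq z y.
have [//|pz1] := pz z.
(* p e_y p is a multiple of p, but its diagonal is 1 at y and 0 at z. *)
have [h hE] : exists h, munit y y = theta h.
  have [_ K] := AutA_inv_funK theta.
  by exists (AutA_inv_fun theta (munit y y)); rewrite K.
have ppE : p * munit y y * p = h x x *: p.
  by rewrite hE -!AutAM munitMmunit AutAZ.
have := congr1 (fun f => incalg_fun f z z) ppE.
have := congr1 (fun f => incalg_fun f y y) ppE.
rewrite !incalgM_diag !incalgZ py pz1 !mulr1 !mul1r !munitE// !eqxx => <-.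
by rewrite (negbTE zy) => /esym/eqP; rewrite oner_eq0.
Qed.

Lemma AutAK theta : cancel theta (theta^-1%g : AutA X F).
Proof. by have [K _] := AutA_inv_funK theta. Qed.

Lemma AutAKV theta : cancel (theta^-1%g : AutA X F) theta.
Proof. by have [_ K] := AutA_inv_funK theta. Qed.

(** The index maps t of theta and s of its inverse are mutually inverse: apply
    theta to e_x theta^-1(e_y) e_x, a multiple of e_x by a diagonal entry, and
    compare the entries at (t x, t x). *)
Lemma AutA_munit_permutation theta : exists t s : X -> X,
  [/\ cancel t s, cancel s t
    & forall x z, theta (munit x x) z z = (z == t x)%:R].
Proof.
have [t tE] := choice (AutA_munit_diag theta).
have [s sE] := choice (AutA_munit_diag (theta^-1%g : AutA X F)).
have ts x y : (y == t x) = (x == s y).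
  have := munitMmunit x ((theta^-1%g : AutA X F) (munit y y) : A) x.
  move/(congr1 (fun f => theta f (t x) (t x))).
  rewrite !AutAM AutAZ AutAKV !incalgM_diag incalgZ tE sE eqxx munitE//.
  rewrite andbb mulr1 mul1r mulr1 [t x == y]eq_sym => /eqP.
  by case: (y == t x); case: (x == s y); rewrite //= ?[0 == 1]eq_sym oner_eq0.
exists t, s; split=> // x; apply/esym/eqP; first by rewrite -ts.
by rewrite ts.
Qed.

(** A multiplicative system extended to pairs x <= y; this forces the value 1 on
    the diagonal. *)
Definition cocycle (m : X -> X -> F) : Prop :=
  (forall x y, (x <= y)%O -> m x y != 0) /\
  (forall x z y, (x <= z)%O -> (z <= y)%O -> m x y = m x z * m z y).

Definition twist (m : X -> X -> F) (s : X -> X) f : A :=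
  mk_incalg (fun x y => m x y * f (s x) (s y)).

(** Reduction to an automorphism that permutes the e_x: it then maps
    e_x A e_y onto e_(t x) A e_(t y), and these spaces have dimension at most
    one. *)
Lemma AutA_decomposition theta : exists u w m s,
  [/\ forall x, u x x = 1, w * u = 1 /\ u * w = 1, order_automorphism s,
      cocycle m & forall f, theta f = w * twist m s f * u].
Proof.
have [t [s [tK sK tE]]] := AutA_munit_permutation theta.
pose u : A := mk_incalg (fun x y => theta (munit (s x) (s x)) x y).
have uE x y : u x y = theta (munit (s x) (s x)) x y.
  by have [xy|xy] := boolP (x <= y)%O; [exact: mk_incalgE|rewrite !incalg0].
have u1 x : u x x = 1 by rewrite uE tE sK eqxx.
have [w [wu uw]] := unipotent_invertible u1.
(* Row y of u is row y of theta(e_(s y)), and the theta(e_x) are orthogonal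
   idempotents, so u conjugates theta(e_x) into e_(t x). *)
have u_munit x : u * theta (munit x x) = munit (t x) (t x) * u.
  apply: incalgP => z y zy; rewrite munitM// incalgM.
  under eq_bigr do rewrite uE.
  rewrite -incalgM -AutAM uE tK.
  have [->|zx] := eqVneq z (t x); first by rewrite tK munit_comp ?mul1r.
  rewrite mul0r (_ : munit _ _ * _ = 0) ?AutA0//; apply: incalgP => a b _.
  rewrite munitM// munitE//.
  by case: (s z =P x) zx => [<-|]; rewrite ?sK ?eqxx// mulr0.
pose th f : A := u * theta f * w.
have thM f g : th (f * g) = th f * th g.
  by rewrite /th AutAM !mulrA -[_ * w * u]mulrA wu mulr1.
have thZ a f : th (a *: f) = a *: th f.
  by rewrite /th AutAZ incalg_scalerAr incalg_scalerAl.
have thK f : w * th f * u = theta f.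
  by rewrite /th !mulrA wu mul1r -mulrA wu mulr1.
have th_munit x : th (munit x x) = munit (t x) (t x).
  by rewrite /th u_munit -mulrA uw mulr1.
pose m x y := th (munit x y) (t x) (t y).
have thE f x y : th f (t x) (t y) = m x y * f x y.
  have := congr1 (fun f => incalg_fun (th f) (t x) (t y)) (munitMmunit x f y).
  by rewrite !thM !th_munit thZ Mmunit// munitM// !eqxx mul1r mulr1 incalgZ mulrC.
have m_neq0 x y : (x <= y)%O -> m x y != 0.
  move=> xy; apply/eqP => m0.
  have : th (munit x y) = 0.
    have -> : munit x y = munit x x * munit x y * munit y y :> A.
      by rewrite !munit_comp.
    rewrite !thM !th_munit munitMmunit [incalg_fun _ _ _]m0.
    by apply: incalgP => a b _; rewrite incalgZ mul0r.
  move=> th0; have := thK (munit x y); rewrite th0 mulr0 mul0r.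
  rewrite -(AutA0 theta) => /AutA_inj/esym/eqP; apply/negP; exact: munit_neq0.
have tmono : {mono t : x y / (x <= y)%O}.
  move=> x y; apply/idP/idP => [txy|xy]; last first.
    by apply: contraLR (m_neq0 _ _ xy) => txy; rewrite /m incalg0 ?eqxx.
  have [h hE] : exists h, munit (t x) (t y) = th h.
    exists ((theta^-1%g : AutA X F) (w * munit (t x) (t y) * u)).
    by rewrite /th AutAKV !mulrA uw mul1r -mulrA uw mulr1.
  have := @munitE _ X F _ _ (t x) (t y) txy; rewrite hE thE !eqxx.
  apply: contra_eqT => xy; rewrite incalg0// mulr0 eq_sym; exact: oner_neq0.
have smono : {mono s : x y / (x <= y)%O} by move=> x y; rewrite -tmono !sK.
exists u, w, (fun x y => m (s x) (s y)), s; split=> //.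
- by split=> //; exists t.
- split=> [x y xy|x z y xz zy]; first by rewrite m_neq0 ?smono.
  rewrite /m -(munit_comp (z := s z)) ?smono// thM.
  have -> : munit (s x) (s z) = munit (s x) (s z) * munit (s z) (s z) :> A.
    by rewrite munit_comp ?smono.
  by rewrite thM th_munit MmunitM Mmunit ?eqxx ?mulr1.
move=> f; rewrite -thK; congr (_ * _ * _); apply: incalgP => x y xy.
transitivity (m (s x) (s y) * f (s x) (s y)); first by rewrite -thE !sK.
by rewrite [RHS]mk_incalgE.
Qed.

End AlgebraAutomorphisms.

(** * Transposition between the coalgebra and the algebra *)

Section Transpose.
Context {d : Order.disp_t} {X : locFinPOrderType d} {F : fieldType}.
Local Notation A := (incalg X F).
Local Notation C := (Co X F).
Local Notation interval := Defs.interval.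
Local Coercion incalg_fun : incalg >-> Funclass.
Local Coercion dual_fun : dual >-> Funclass.
Local Coercion AutA_fun : AutA >-> Funclass.
Local Coercion AutC_fun : AutC >-> Funclass.
Implicit Types (f g h u v w : A) (x y z : X) (theta : AutA X F).
Implicit Types (phi psi : {linear C -> C}) (c : C) (i : itv_index X).

Lemma PsiU f i : Psi f << i >> = f (val i).1 (val i).2.
Proof. by rewrite -itv_val PsiE// (valP i). Qed.

Lemma munit_val i j :
  munit (val i).1 (val i).2 (val j).1 (val j).2 = (j == i)%:R :> F.
Proof. by rewrite munitE ?(valP i)// -xpair_eqE -!surjective_pairing val_eqE. Qed.

Lemma Psi_munit i c : Psi (munit (val i).1 (val i).2) c = c@_i.
Proof.
rewrite [LHS]/(linext _ c) [in RHS](monalgE c) [RHS]raddf_sum /linext.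
apply: eq_bigr => j _; rewrite [incalg_fun _ _ _]munit_val /= mcoeffU.
exact: mulr_natr.
Qed.

Lemma Psi_separates c c' : (forall f, Psi f c = Psi f c') -> c = c'.
Proof. by move=> cc'; apply/malgP => i; rewrite -!Psi_munit. Qed.

Lemma tensor_form_munit i j (t : CoCo X F) :
  tensor_form (Psi (munit (val i).1 (val i).2))
              (Psi (munit (val j).1 (val j).2)) t = t@_(i, j).
Proof.
rewrite [in RHS](monalgE t) [RHS]raddf_sum /tensor_form /linext.
apply: eq_bigr => -[k l] _.
transitivity (t@_(k, l) *: ((k == i)%:R * (l == j)%:R : F^o)).
  by congr (_ *: (_ * _)); rewrite PsiU munit_val.
rewrite /= mcoeffU -natrM mulnb xpair_eqE; exact: mulr_natr.
Qed.

Lemma Theta_endE phi f x y : (x <= y)%O ->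
  Theta_end phi f x y = Psi f (phi (itv F x y)).
Proof. by move=> xy; rewrite PhiE. Qed.

Lemma Theta_end_inj phi psi : Theta_end phi =1 Theta_end psi -> phi =1 psi.
Proof.
move=> e; apply: eq_linear_basis => i; apply: Psi_separates => f.
by rewrite -itv_val -!Theta_endE ?(valP i)// e.
Qed.

Lemma Theta_end_comp phi psi f :
  Theta_end phi (Theta_end psi f) = Theta_end (psi \o phi) f.
Proof. by rewrite /Theta_end /= PhiK; congr Phi; exact/val_inj. Qed.

Lemma Theta_end_id f : Theta_end idfun f = f.
Proof. by rewrite -[RHS]PsiK; congr Phi; exact/val_inj. Qed.

(** In the decomposition of theta, the entry at (x, y) is a finite combination of
    values of f; the same combination of basis intervals is the image of [x, y]
    under the transposed map. *)
Lemma AutA_transpose theta : exists phi, theta =1 Theta_end phi.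
Proof.
have [u [w [m [s [_ _ [_ smono] _ thE]]]]] := AutA_decomposition theta.
pose b (i : itv_index X) : C := \sum_(t <- interval (val i).1 (val i).2)
  \sum_(z <- interval (val i).1 t)
    (w (val i).1 z * m z t * u t (val i).2) *: itv F (s z) (s t).
exists (linext b : {linear _ -> _}) => f; apply: incalgP => x y xy.
rewrite Theta_endE//; case: (Defs.itvP F xy) => i ixy ->.
transitivity (Psi f (b i)); last first.
  by congr (dual_fun (Psi f) _); rewrite [RHS]linextU.
rewrite /b ixy [fst _]/= [snd _]/= thE incalgM linear_sum; apply: eq_bigr => t _.
rewrite linear_sum incalgM mulr_suml big_seq [RHS]big_seq; apply: eq_bigr => z.
rewrite in_interval => /andP[xz zt].
transitivity ((w x z * m z t * u t y) * Psi f (itv F (s z) (s t))); last first.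
  exact/esym/linearZ.
by rewrite PsiE ?smono// mk_incalgE// mulrA mulrAC.
Qed.

(** Bijectivity of the transposed map comes from transposing theta^-1 as well;
    compatibility with Delta is tested against products of two coefficient
    functionals, where it becomes multiplicativity of theta, and compatibility
    with the counit amounts to theta(1) = 1. *)
Lemma Theta_surj theta : exists phi : AutC X F, Theta X F phi = theta.
Proof.
have [phi phiE] := AutA_transpose theta.
have [psi psiE] := AutA_transpose (theta^-1%g).
have phiK : cancel phi psi.
  apply: (Theta_end_inj (phi := psi \o phi) (psi := idfun)) => f.
  by rewrite Theta_end_id -Theta_end_comp -phiE -psiE AutAKV.
have psiK : cancel psi phi.
  apply: (Theta_end_inj (phi := phi \o psi) (psi := idfun)) => f.
  by rewrite Theta_end_id -Theta_end_comp -phiE -psiE AutAK.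
have dual_mapE chi : dual_map phi chi = Psi (theta (Phi chi)).
  by rewrite phiE /Theta_end /= !PhiK.
have aut : coalgebra_automorphism phi.
  split=> [|||c]; first exact: linearP.
  - by exists psi.
  - move=> c; apply/malgP => -[i j]; rewrite -!tensor_form_munit tensor_form_map.
    set chi := Psi _; set xi := Psi _.
    rewrite -[LHS]/(dual_fun (dual_mul (dual_map phi chi) (dual_map phi xi)) c).
    rewrite -[RHS]/(dual_fun (dual_map phi (dual_mul chi xi)) c).
    by rewrite !dual_mapE PhiM AutAM PsiM.
  transitivity (dual_fun (dual_map phi 1) c) => //.
  by rewrite dual_mapE Phi1 AutA1 Psi1.
exists (exist _ (phi : C -> C) (asboolT aut)); apply: AutA_eq => f.
by rewrite phiE; congr Phi; exact/val_inj.
Qed.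

Lemma Theta_inj : injective (Theta X F).
Proof.
move=> phi psi /(congr1 (@AutA_fun _ _ _)) e; apply: AutC_eq.
by apply: Theta_end_inj => f; exact: (congr1 (@^~ f) e).
Qed.

Lemma ThetaM (phi psi : AutC X F) :
  Theta X F (phi * psi)%g = (Theta X F psi * Theta X F phi)%g.
Proof.
apply: AutA_eq => f; rewrite [RHS]Theta_end_comp.
by congr Phi; exact/val_inj.
Qed.

Lemma Theta_antiisomorphism : antiisomorphism (Theta X F).
Proof.
split; last exact: ThetaM.
have [inv invK] := choice Theta_surj.
by exists inv => // phi; apply: Theta_inj; rewrite invK.
Qed.

End Transpose.

(** * The subgroups of Aut C and their products *)

Section Group.
Variable G : groupType.
Implicit Types (N : set G).

Lemma is_subgroup_of_closed N : N 1%g -> (forall x y, N x -> N y -> N (x * y)%g) ->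
  (forall x, N x -> N x^-1%g) -> is_subgroup N.
Proof.
move=> N1 NM NV; apply/is_subgroupP; split=> // x y Nx Ny.
by apply: NM => //; exact: NV.
Qed.

End Group.

Section Factors.
Context {d : Order.disp_t} {X : locFinPOrderType d} {F : fieldType}.
Local Notation A := (incalg X F).
Local Notation interval := Defs.interval.
Local Coercion incalg_fun : incalg >-> Funclass.
Local Coercion dual_fun : dual >-> Funclass.
Local Coercion AutA_fun : AutA >-> Funclass.
Implicit Types (f g h u v w : A) (x y z : X) (theta : AutA X F).
Implicit Types (alpha beta : AutC X F) (m : X -> X -> F) (s t : X -> X).
Local Notation Theta := (Theta X F).

Lemma ThetaME alpha beta f :
  Theta (alpha * beta)%g f = Theta beta (Theta alpha f).
Proof. by rewrite ThetaM. Qed.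

Lemma Theta1E f : Theta 1%g f = f.
Proof. exact: Theta_end_id. Qed.

Lemma ThetaVK alpha f : Theta alpha (Theta alpha^-1%g f) = f.
Proof. by rewrite -ThetaME mulVg Theta1E. Qed.

Lemma Theta_itv alpha f x y : (x <= y)%O ->
  Theta alpha f x y = Psi f (AutC_fun alpha (itv F x y)).
Proof. exact: Theta_endE. Qed.

Lemma cocycle_refl m x : cocycle m -> m x x = 1.
Proof.
move=> [m0 mM]; have /eqP := mM x x x (lexx x) (lexx x).
by rewrite -{1}[m x x]mulr1 -subr_eq0 -mulrBr mulf_eq0 (negbTE (m0 x x _)) ?lexx//=
  subr_eq0 => /eqP.
Qed.

Lemma cocycle1 : cocycle (fun _ _ : X => 1 : F).
Proof. by split=> [*|*]; rewrite ?oner_neq0 ?mulr1. Qed.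

Lemma twistE m s f x y : (x <= y)%O -> twist m s f x y = m x y * f (s x) (s y).
Proof. by move=> xy; rewrite mk_incalgE. Qed.

Lemma cocycle_of_system m : multiplicative_system m ->
  cocycle (fun x y => if x == y then 1 else m x y).
Proof.
move=> [m0 mM]; split=> [x y xy|x z y].
  by case: (eqVneq x y) => [_|xNy]; rewrite ?oner_neq0// m0// lt_neqAle xNy.
rewrite !le_eqVlt => /predU1P[->|xz]; first by rewrite eqxx mul1r.
move=> /predU1P[<-|zy]; first by rewrite eqxx mulr1.
by rewrite (lt_eqF xz) (lt_eqF zy) (lt_eqF (lt_trans xz zy)) -mM.
Qed.

Lemma MultCP alpha : MultC X F alpha <->
  exists2 m, cocycle m & Theta alpha =1 twist m id.
Proof.
split=> [[m [/cocycle_of_system cm mE m1]]|[m cm mE]].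
  eexists; first exact: cm.
  move=> f; apply: incalgP => x y; rewrite le_eqVlt => /predU1P[->|xy].
    by rewrite twistE// Theta_itv// m1 PsiE// eqxx mul1r.
  rewrite twistE ?ltW// Theta_itv ?ltW// mE// (lt_eqF xy).
  by rewrite -(PsiE f (ltW xy)); exact: linearZ.
have itvE x y : (x <= y)%O -> AutC_fun alpha (itv F x y) = m x y *: itv F x y.
  move=> xy; apply: Psi_separates => f; rewrite -Theta_itv// mE twistE//.
  by rewrite -(PsiE f xy); exact/esym/linearZ.
exists m; split=> [|x y xy|x].
- split=> [x y xy|x z y xz zy]; first by case: cm => m0 _; rewrite m0 ?ltW.
  by case: cm => _; apply; exact: ltW.
- by rewrite itvE ?ltW.
by rewrite itvE// cocycle_refl// scale1r.
Qed.

Lemma AutCXP alpha : AutCX X F alpha <->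
  exists2 s, order_automorphism s & Theta alpha =1 twist (fun _ _ => 1) s.
Proof.
split=> -[s os sE]; exists s => //; have [_ smono] := os.
  move=> f; apply: incalgP => x y xy.
  by rewrite twistE// mul1r Theta_itv// sE// PsiE ?smono.
move=> x y xy; apply: Psi_separates => f.
by rewrite -Theta_itv// sE twistE// mul1r PsiE ?smono.
Qed.

Lemma InAutCP alpha : InAutC X F alpha <->
  exists v w, [/\ w * v = 1, v * w = 1 & forall f, Theta alpha f = w * f * v].
Proof.
split=> [[v [w [wv vw vE]]]|[v [w [wv vw vE]]]].
  have PhiM1 chi xi : chi * xi = 1 -> Phi chi * Phi xi = 1.
    by move=> e; rewrite -[LHS]PhiM -[RHS]Phi1; congr Phi.
  exists (Phi v), (Phi w); split; try exact: PhiM1.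
  move=> f; rewrite [LHS]/(Phi (dual_map _ (Psi f))) vE.
  by rewrite [LHS]PhiM [X in X * _]PhiM PsiK.
exists (Psi v), (Psi w); split; try by rewrite -PsiM ?wv ?vw Psi1.
move=> chi; rewrite -[LHS]PhiK.
rewrite -[X in dual_map _ X]PhiK -[Phi (dual_map _ _)]/(Theta alpha (Phi chi)) vE.
by rewrite !PsiM PhiK.
Qed.

Lemma In1AutCP alpha : In1AutC X F alpha <->
  exists v w, [/\ forall x, v x x = 1, w * v = 1, v * w = 1
                & forall f, Theta alpha f = w * f * v].
Proof.
split=> [[g g0 [w [wv vw vE]]]|[v [w [v1 wv vw vE]]]].
  exists (1 + g), w; split=> // x.
  by rewrite incalgD incalg1 eqxx g0 addr0.
exists (v - 1); first by move=> x; rewrite incalgD incalgN incalg1 eqxx v1 subrr.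
by exists w; rewrite addrC subrK.
Qed.

(** The kernel of the action of Aut C on X, expressed through Theta. *)
Definition diag_preserving : set (AutC X F) :=
  [set alpha | forall f x, Theta alpha f x x = f x x].

Lemma conj_twist_diag u w m s f x : w * u = 1 -> cocycle m ->
  incalg_fun (w * twist m s f * u) x x = f (s x) (s x).
Proof.
move=> wu cm; rewrite !incalgM_diag twistE// (cocycle_refl x cm) mul1r mulrAC.
by rewrite -incalgM_diag wu incalg1 eqxx mul1r.
Qed.

(** Conjugation by u does not affect the diagonal, so theta acts there through
    its permutation of X only; this yields both normality statements. *)
Lemma AutA_diag theta : exists2 s, bijective s &
  forall f x, theta f x x = f (s x) (s x).
Proof.
have [u [w [m [s [u1 [wu _] [bs _] cm thE]]]]] := AutA_decomposition theta.
by exists s => // f x; rewrite thE conj_twist_diag.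
Qed.

Lemma diag_preserving_subgroup : is_subgroup diag_preserving.
Proof.
apply: is_subgroup_of_closed => [f x|a b Da Db f x|a Da f x].
- by rewrite Theta1E.
- by rewrite ThetaME Db.
by rewrite -Da ThetaVK.
Qed.

Lemma diag_preserving_normal alpha beta :
  diag_preserving alpha -> diag_preserving (alpha ^ beta)%g.
Proof.
move=> Da f x; have [s _ sE] := AutA_diag (Theta beta).
rewrite conjgE ThetaME ThetaME sE Da -sE ThetaVK//.
Qed.

Lemma MultC_subgroup : is_subgroup (MultC X F).
Proof.
apply: is_subgroup_of_closed => [|a b|a].
- apply/MultCP; exists (fun _ _ => 1); first exact: cocycle1.
  by move=> f; apply: incalgP => x y xy; rewrite Theta1E twistE// mul1r.
- move=> /MultCP[m [m0 mM] mE] /MultCP[n [n0 nM] nE]; apply/MultCP.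
  exists (fun x y => n x y * m x y).
    split=> [x y xy|x z y xz zy]; first by rewrite mulf_neq0 ?m0 ?n0.
    by rewrite (mM x z y)// (nM x z y)// mulrACA.
  by move=> f; apply: incalgP => x y xy; rewrite ThetaME mE nE !twistE// mulrA.
move=> /MultCP[m [m0 mM] mE]; apply/MultCP; exists (fun x y => (m x y)^-1).
  split=> [x y xy|x z y xz zy]; first by rewrite invr_eq0 m0.
  by rewrite (mM x z y)// invfM.
move=> f; apply: incalgP => x y xy; rewrite twistE// -[in RHS](ThetaVK a f) mE.
by rewrite twistE// mulKf ?m0.
Qed.

Lemma order_automorphism_comp s t : order_automorphism s -> order_automorphism t ->
  order_automorphism (s \o t).
Proof.
move=> [bs ms] [bt mt]; split; first exact: bij_comp.
by move=> x y; rewrite /= ms mt.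
Qed.

Lemma order_automorphism_inv s : order_automorphism s ->
  exists t, [/\ order_automorphism t, cancel s t & cancel t s].
Proof.
move=> [[t sK tK] smono]; exists t; split=> //; split; first by exists s.
by move=> x y; rewrite -smono !tK.
Qed.

Lemma AutCX_subgroup : is_subgroup (AutCX X F).
Proof.
apply: is_subgroup_of_closed => [|a b|a].
- apply/AutCXP; exists id; first by split=> //; exists id.
  by move=> f; apply: incalgP => x y xy; rewrite Theta1E twistE// mul1r.
- move=> /AutCXP[s os sE] /AutCXP[t ot tE]; apply/AutCXP; exists (s \o t).
    exact: order_automorphism_comp.
  move=> f; apply: incalgP => x y xy; rewrite ThetaME sE tE.
  by rewrite !twistE ?mul1r//; case: ot => _ ->.
move=> /AutCXP[s os sE]; have [t [ot sK tK]] := order_automorphism_inv os.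
apply/AutCXP; exists t => // f; apply: incalgP => x y xy.
rewrite twistE// mul1r -[in RHS](ThetaVK a f) sE twistE ?mul1r ?tK//.
by case: ot => _ ->.
Qed.

Lemma In1AutC_subgroup : is_subgroup (In1AutC X F).
Proof.
apply: is_subgroup_of_closed => [|a b|a].
- apply/In1AutCP; exists 1, 1; split=> [x|||f]; rewrite ?mulr1 ?mul1r//.
    by rewrite incalg1 eqxx.
  by rewrite Theta1E.
- move=> /In1AutCP[v [w [v1 wv vw vE]]] /In1AutCP[v' [w' [v1' wv' vw' vE']]].
  apply/In1AutCP; exists (v * v'), (w' * w); split=> [x|||f].
  + by rewrite incalgM_diag v1 v1' mulr1.
  + by rewrite mulrA -(mulrA w') wv mulr1.
  + by rewrite mulrA -(mulrA v) vw' mulr1.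
  by rewrite ThetaME vE vE' !mulrA.
move=> /In1AutCP[v [w [v1 wv vw vE]]]; apply/In1AutCP; exists w, v.
split=> // [x|f].
  by rewrite -[LHS]mulr1 -(v1 x) -incalgM_diag wv incalg1 eqxx.
have /(congr1 (fun h => v * h * w)) := ThetaVK a f.
by rewrite vE !mulrA vw mul1r -mulrA vw mulr1.
Qed.

Lemma In1AutC_normal alpha beta :
  In1AutC X F alpha -> In1AutC X F (alpha ^ beta)%g.
Proof.
move=> /In1AutCP[v [w [v1 wv vw vE]]]; apply/In1AutCP.
exists (Theta beta v), (Theta beta w); split=> [x|||f].
- by have [s _ sE] := AutA_diag (Theta beta); rewrite sE.
- by rewrite -AutAM wv AutA1.
- by rewrite -AutAM vw AutA1.
by rewrite conjgE !ThetaME vE !AutAM ThetaVK.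
Qed.

Lemma InAutC_diag : InAutC X F `<=` diag_preserving.
Proof.
move=> a /InAutCP[v [w [wv _ vE]]] f x; rewrite vE !incalgM_diag.
by rewrite mulrAC -incalgM_diag wv incalg1 eqxx mul1r.
Qed.

Lemma MultC_diag : MultC X F `<=` diag_preserving.
Proof.
by move=> a /MultCP[m cm mE] f x; rewrite mE twistE// cocycle_refl ?mul1r.
Qed.

Lemma In1AutC_sub : In1AutC X F `<=` InAutC X F.
Proof.
by move=> a /In1AutCP[v [w [_ wv vw vE]]]; apply/InAutCP; exists v, w.
Qed.

Lemma algebra_automorphism_Theta (h : A -> A) :
  algebra_automorphism h -> exists alpha, Theta alpha =1 h.
Proof.
move=> /asboolT hP.
have [alpha aE] := Theta_surj
  (exist (fun k => is_true `[< algebra_automorphism k >]) h hP : AutA X F).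
by exists alpha => f; rewrite aE.
Qed.

Lemma inner_aut v w : w * v = 1 -> v * w = 1 ->
  exists alpha, forall f, Theta alpha f = w * f * v.
Proof.
move=> wv vw.
have aut : algebra_automorphism (fun f => w * f * v).
  split=> [a f g||].
  - by rewrite mulrDr mulrDl incalg_scalerAr incalg_scalerAl.
  - split=> [|f g]; first by rewrite mulr1.
    by rewrite !mulrA -[_ * v * w]mulrA vw mulr1.
  by exists (fun f => v * f * w) => f; rewrite !mulrA ?wv ?vw mul1r -mulrA
     ?wv ?vw mulr1.
have [alpha aE] := algebra_automorphism_Theta aut.
by exists alpha.
Qed.

(** The e_x detect that the permutation of X is trivial. *)
Lemma munit_diag_eq s : (forall f x, f (s x) (s x) = f x x) -> s =1 id.
Proof.
move=> sE x; have := sE (munit x x) x; rewrite !munitE// eqxx /=.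
by case: eqP => //= _ /esym/eqP; rewrite oner_eq0.
Qed.

Lemma twist_automorphism m s : cocycle m -> order_automorphism s ->
  algebra_automorphism (twist m s).
Proof.
move=> cm os; have [_ smono] := os.
have [t [[_ tmono] sK tK]] := order_automorphism_inv os.
have [m0 mM] := cm; split.
- move=> a f g; apply: incalgP => x y xy.
  by rewrite incalgD incalgZ !twistE// incalgD incalgZ mulrDr mulrCA.
- split=> [|f g]; apply: incalgP => x y xy; rewrite twistE// ?incalg1.
    rewrite (can_eq sK); case: eqVneq => [->|_]; rewrite ?mulr0//.
    by rewrite cocycle_refl// mulr1.
  have sI : interval (s x) (s y) = [fset s z | z in interval x y]%fset.
    apply/fsetP => z; rewrite in_interval; apply/idP/imfsetP => [|[k /= + ->]].
      move=> szs; exists (t z); rewrite ?tK//= in_interval.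
      by rewrite -smono -[(t z <= y)%O]smono tK.
    by rewrite in_interval !smono.
  rewrite !incalgM sI big_imfset; last by move=> ? ? _ _; exact: (can_inj sK).
  rewrite mulr_sumr big_seq [RHS]big_seq; apply: eq_bigr => z.
  by rewrite in_interval => /andP[xz zy]; rewrite !twistE// (mM x z y)// mulrACA.
exists (twist (fun x y => (m (t x) (t y))^-1) t) => f; apply: incalgP => x y xy.
  by rewrite !twistE ?tmono// !tK mulKf ?m0 ?tmono.
by rewrite !twistE ?smono// !sK mulVKf ?m0.
Qed.

Lemma twist_aut m s : cocycle m -> order_automorphism s ->
  exists alpha, Theta alpha =1 twist m s.
Proof.
move=> cm os.
exact: algebra_automorphism_Theta (twist_automorphism cm os).
Qed.

(** Here s = id in the decomposition, leaving a conjugation after a twist.  Theta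
    reverses composition, so the conjugation comes out as the right factor and
    is moved to the left by normality of In_1. *)
Lemma diag_preserving_factor :
  diag_preserving `<=` setprod (In1AutC X F) (MultC X F).
Proof.
move=> a Da.
have [u [w [m [s [u1 [wu uw] os cm aE]]]]] := AutA_decomposition (Theta a).
have sid : s =1 id.
  by apply: munit_diag_eq => f x; rewrite -[RHS]Da aE conj_twist_diag.
have [b bE] := twist_aut cm os.
have Mb : MultC X F b.
  apply/MultCP; exists m => // f; apply: incalgP => x y xy.
  by rewrite bE !twistE// !sid.
have [n nE] := inner_aut wu uw.
have In : In1AutC X F n by apply/In1AutCP; exists u, w.
exists (n ^ b^-1)%g; first exact: In1AutC_normal.
exists b => //; rewrite -conjgCV; apply: Theta_inj; apply: AutA_eq => f.
by rewrite ThetaME nE bE aE.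
Qed.

Lemma In1_Mult_eq_diag : setprod (In1AutC X F) (MultC X F) = diag_preserving.
Proof.
apply/seteqP; split; last exact: diag_preserving_factor.
move=> _ [n In1n [b Mb <-]] f x; rewrite ThetaME (MultC_diag Mb).
exact: (InAutC_diag (In1AutC_sub In1n)).
Qed.

Lemma In_Mult_eq_diag : setprod (InAutC X F) (MultC X F) = diag_preserving.
Proof.
apply/seteqP; split; last first.
  rewrite -In1_Mult_eq_diag => _ [n In1n [b Mb <-]]; exists n.
    exact: In1AutC_sub.
  by exists b.
move=> _ [n Inn [b Mb <-]] f x; rewrite ThetaME (MultC_diag Mb).
exact: (InAutC_diag Inn).
Qed.

(** The order automorphism s of the decomposition gives an element of Aut_C X with
    the same action on X; dividing by it leaves a diagonal-preserving
    automorphism. *)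
Lemma diag_preserving_AutCX : setprod diag_preserving (AutCX X F) = [set: AutC X F].
Proof.
apply/seteqP; split=> // a _.
have [u [w [m [s [u1 [wu uw] os cm aE]]]]] := AutA_decomposition (Theta a).
have [r rE] := twist_aut cocycle1 os.
exists (a * r^-1)%g; last first.
  exists r; last exact: mulgVK.
  by apply/AutCXP; exists s.
move=> f x; have [[t _ tK] _] := os; rewrite -(tK x).
have := rE (Theta r^-1%g (Theta a f)); rewrite ThetaVK.
move=> /(congr1 (fun g => incalg_fun g (t x) (t x))).
by rewrite twistE// mul1r ThetaME => <-; rewrite aE conj_twist_diag.
Qed.

Lemma diag_preservingI_AutCX : diag_preserving `&` AutCX X F = [set 1%g].
Proof.
apply/seteqP; split=> [a [Da /AutCXP[s _ sE]]|_ ->]; last first.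
  split; first by have /is_subgroupP[] := diag_preserving_subgroup.
  by have /is_subgroupP[] := AutCX_subgroup.
have sid : s =1 id.
  by apply: munit_diag_eq => f x; rewrite -[RHS]Da sE twistE// mul1r.
apply: Theta_inj; apply: AutA_eq => f; apply: incalgP => x y xy.
by rewrite Theta1E sE twistE// mul1r !sid.
Qed.

(** An element of Mult C fixes every e_x, so a conjugating element v commutes with them and
    vanishes off the diagonal. *)
Lemma In1AutCI_MultC : In1AutC X F `&` MultC X F = [set 1%g].
Proof.
apply/seteqP; split=> [a [/In1AutCP[v [w [v1 wv vw vE]]]]|_ ->]; last first.
  split; first by have /is_subgroupP[] := In1AutC_subgroup.
  by have /is_subgroupP[] := MultC_subgroup.
move=> /MultCP[m cm mE].
have v_munit x : munit x x * v = v * munit x x.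
  rewrite -[LHS]mul1r -vw -!mulrA [w * _]mulrA -vE mE.
  rewrite (_ : twist m id (munit x x) = munit x x)//.
  apply: incalgP => y z yz; rewrite twistE// munitE//.
  case: (y =P x) => [->|_]; case: (z =P x) => [->|_]; rewrite ?mulr0//.
  by rewrite cocycle_refl ?mulr1.
have v_eq1 : v = 1.
  apply: incalgP => x y xy; rewrite incalg1.
  have := congr1 (fun f => incalg_fun f x y) (v_munit x).
  rewrite munitM// Mmunit// eqxx mul1r v1 mul1r eq_sym => ->//.
apply: Theta_inj; apply: AutA_eq => f.
by move: wv; rewrite Theta1E vE v_eq1 !mulr1 => ->; rewrite mul1r.
Qed.

End Factors.

Theorem theorem8p1 (d : Order.disp_t) (X : locFinPOrderType d) (F : fieldType) :
  [/\ internal_sdprod (setprod (InAutC X F) (MultC X F)) (AutCX X F)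
        [set: AutC X F]%classic,
      internal_sdprod (In1AutC X F) (MultC X F)
        (setprod (In1AutC X F) (MultC X F))
    & internal_sdprod (setprod (In1AutC X F) (MultC X F)) (AutCX X F)
        [set: AutC X F]%classic]
  /\
  (antiisomorphic (AutC X F) (AutA X F) /\ antiisomorphism (Theta X F)).
Proof.
have DX : internal_sdprod (@diag_preserving d X F) (AutCX X F) [set: AutC X F].
  split.
  - exact: diag_preserving_subgroup.
  - exact: AutCX_subgroup.
  - by rewrite diag_preserving_AutCX.
  - exact: diag_preservingI_AutCX.
  by move=> n k Dn _; exact: diag_preserving_normal.
split; last first.
  by split; [exists (Theta X F)|]; exact: Theta_antiisomorphism.
split; [by rewrite In_Mult_eq_diag| |by rewrite In1_Mult_eq_diag].
split=> //.
- exact: In1AutC_subgroup.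
- exact: MultC_subgroup.
- exact: In1AutCI_MultC.
by move=> n k In1n _; exact: In1AutC_normal.
Qed.
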